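(* For any positive integer $m$ and any sequence $\alpha=(\alpha_{k+m})_{k\in\mathbb N}$ of commuting indeterminates, the matrix of modified $m$-Stieltjes-Rogers polynomials $\hat{\mathrm S}^{(m)}=\left(S^{(m;j)}_{n}(\alpha)\right)_{n,j\in\mathbb N}$ is totally positive in the polynomial ring $\mathbb Z[\alpha]$ equipped with the coefficient-wise partial order.
   Context: $\mathbb N=\{0,1,2,\dots\}$. For a positive integer $m$, a partial $m$-Dyck path is a finite path in $\mathbb N\times\mathbb N$ using steps $(1,1)$ (rises) and $(1,-m)$ ($m$-falls), allowed to start and end anywhere in $\mathbb N\times\mathbb N$. Given a sequence $\alpha=(\alpha_i)_{i\ge m}$, each rise gets weight $1$ and each $m$-fall from height $i$ gets weight $\alpha_i$; the weight of a path is the product of the weights of its steps. The modified $m$-Stieltjes-Rogers polynomial of type $j$, $S^{(m;j)}_{n}(\alpha)$, is the sum of the weights of all partial $m$-Dyck paths from $(0,0)$ to $((m+1)n+j,j)$. In the coefficient-wise partial order, an element of $\mathbb Z[\alpha]$ is nonnegative if all its coefficients are nonnegative. A (possibly infinite) matrix with entries in $\mathbb Z[\alpha]$ is totally positive (for this order) if all its finite minors are nonnegative, i.e. are polynomials with nonnegative coefficients. *)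

(* Defs.v *)
From HB Require Import structures.
From mathcomp Require Import all_boot all_order all_algebra.
From mathcomp Require Import monalg.

Set Implicit Arguments.
Unset Strict Implicit.
Unset Printing Implicit Defensive.
Import GRing.Theory Num.Theory.
Local Open Scope ring_scope.

(* A path in N x N is given by its starting point and its word of steps:
   [true] is the rise (1, 1) and [false] is the m-fall (1, -m). *)
Definition step_ok (m : nat) (p : nat * nat) (b : bool) : bool :=
  b || (m <= p.2)%N.

Definition step_end (m : nat) (p : nat * nat) (b : bool) : nat * nat :=
  if b then (p.1.+1, p.2.+1) else (p.1.+1, (p.2 - m)%N).

(* [step_ok] makes the truncated subtraction in [step_end] exact, so this says
   precisely that every vertex of the path lies in N x N. *)
Fixpoint is_partial_Dyck (m : nat) (p : nat * nat) (s : seq bool) : bool :=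
  if s is b :: s' then step_ok m p b && is_partial_Dyck m (step_end m p b) s'
  else true.

Definition path_end (m : nat) (p : nat * nat) (s : seq bool) : nat * nat :=
  foldl (step_end m) p s.

Lemma path_end1 (m : nat) (p : nat * nat) (s : seq bool) :
  (path_end m p s).1 = (p.1 + size s)%N.
Proof.
rewrite /path_end; elim: s p => [|b s IHs] p /=; first by rewrite addn0.
by rewrite IHs addnS -addSn /step_end; case: b.
Qed.

(* The sequence [alpha] is shifted: [alpha k] is alpha_{k+m}, so the m-fall
   from height h >= m has weight [alpha (h - m)]. *)
Definition step_weight (R : comNzRingType) (m : nat) (alpha : nat -> R)
    (p : nat * nat) (b : bool) : R :=
  if b then 1 else alpha (p.2 - m)%N.

Fixpoint path_weight (R : comNzRingType) (m : nat) (alpha : nat -> R)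
    (p : nat * nat) (s : seq bool) : R :=
  if s is b :: s' then
    step_weight m alpha p b * path_weight m alpha (step_end m p b) s'
  else 1.

(* By [path_end1], every path from (0,0) to ((m+1)n+j, j) has exactly (m+1)n+j
   steps, so summing over words of that length misses no path. *)
Definition stieltjes_rogers (R : comNzRingType) (m : nat) (alpha : nat -> R)
    (n j : nat) : R :=
  let N := (m.+1 * n + j)%N in
  \sum_(s : N.-tuple bool |
        is_partial_Dyck m (0%N, 0%N) s && (path_end m (0%N, 0%N) s == (N, j)))
     path_weight m alpha (0%N, 0%N) s.

(* Z[alpha], in countably many commuting indeterminates indexed by nat. *)
Definition Zalpha : comNzRingType := {malg int[{cmonom nat}]}.

Definition indet (k : nat) : Zalpha := (<< ucm k >> : {malg int[{cmonom nat}]}).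

Definition coef_nonneg (p : Zalpha) : Prop :=
  forall u : {cmonom nat}, 0 <= (p : {malg int[{cmonom nat}]})@_u.

Definition totally_positive (M : nat -> nat -> Zalpha) : Prop :=
  forall (k : nat) (r c : 'I_k -> nat),
    (forall i i' : 'I_k, (i < i')%N -> (r i < r i')%N) ->
    (forall j j' : 'I_k, (j < j')%N -> (c j < c j')%N) ->
    coef_nonneg (\det (\matrix_(i < k, j < k) M (r i) (c j))).

(* Main.v *)
(** Decomposing a path by its last step gives [S n.+1 j = \sum_(i <= j) alpha_i
    S n (i + m)] with [S 0 j = 1], that is [S = T U] where [U] is the upper
    triangular all-ones matrix, row [0] of [T] is [(1, 0, 0, ...)] and row
    [n.+1] of [T] is obtained from row [n] of [S] by shifting and scaling the
    columns.  A minor of [S] is a sum of minors of [T] over column sets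
    interlacing the given one, and a minor of [T] is either [0] or a monomial
    times a minor of [S] on smaller row indices; induct on the rows. *)
Require Import Defs.
From mathcomp Require Import all_boot all_order all_algebra.
From mathcomp Require Import monalg.

Set Implicit Arguments.
Unset Strict Implicit.
Unset Printing Implicit Defensive.
Import GRing.Theory Num.Theory.
Local Open Scope ring_scope.

Definition increasing (k : nat) (r : 'I_k -> nat) : Prop :=
  forall i i' : 'I_k, (i < i')%N -> (r i < r i')%N.

(** * Determinants of matrices of partial sums *)

Section Determinants.
Variable R : comNzRingType.

(** Multilinearity in the columns. After transposition each Leibniz product runs over the columns,
    and distributing it over the inner sums picks one index per column. *)
Lemma det_sum_cols (k N : nat) (Q : 'I_k -> pred 'I_N) (F : 'I_k -> 'I_N -> R) :
  \det (\matrix_(i, j) \sum_(x | Q j x) F i x) =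
  \sum_(f in family Q) \det (\matrix_(i, j) F i (f j)).
Proof.
rewrite -det_tr [LHS]/determinant.
under [RHS]eq_bigr => f _ do rewrite -det_tr /determinant.
rewrite exchange_big /=; apply: eq_bigr => s _.
rewrite -mulr_sumr; congr (_ * _).
under eq_bigr => i _ do rewrite !mxE.
rewrite bigA_distr_big_dep; apply: eq_bigr => f _.
by apply: eq_bigr => i _; rewrite !mxE.
Qed.

(* The entries [D] are the differences of consecutive columns. *)
Lemma det_cumulative_cols (k : nat) (D : 'M[R]_k) :
  \det (\matrix_(i, j) \sum_(l < k | (l <= j)%N) D i l) = \det D.
Proof.
pose U : 'M[R]_k := \matrix_(l, j) (l <= j)%N%:R.
have detU : \det U = 1.
  rewrite -det_tr det_trig; last first.
    by apply/is_trig_mxP => i j ltij; rewrite !mxE leqNgt ltij.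
  by rewrite big1 // => i _; rewrite !mxE leqnn.
rewrite -[RHS]mulr1 -detU -det_mulmx; congr (\det _).
apply/matrixP => i j; rewrite !mxE big_mkcond; apply: eq_bigr => l _.
by rewrite !mxE; case: leqP; rewrite ?mulr1 ?mulr0.
Qed.

(** The [b l] cut the summation range into consecutive blocks. Subtracting from each column the
    preceding one leaves the sum of [T] over one block per column, and multilinearity then chooses
    one index in each block. *)
Lemma det_partial_sums (k : nat) (T : 'I_k.+1 -> nat -> R) (c : 'I_k.+1 -> nat) :
  increasing c ->
  let b l := if l is l'.+1 then (c (inord l')).+1 else 0%N in
  \det (\matrix_(i, j) \sum_(x < (c j).+1) T i x) =
  \sum_(f in family (fun (j : 'I_k.+1) (x : 'I_(b k.+1)) => (b j <= x < b j.+1)%N))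
     \det (\matrix_(i, j) T i (f j)).
Proof.
move=> c_incr b.
have b_mono l l' : (l <= l' <= k.+1)%N -> (b l <= b l')%N.
  case: l l' => [|l] [|l'] //= /andP[].
  rewrite ltnS leq_eqVlt => /predU1P[-> //|ltl ltl'].
  by rewrite ltnS ltnW // c_incr // !inordK // (ltn_trans ltl).
rewrite -(det_sum_cols (fun (j : 'I_k.+1) x => (b j <= x < b j.+1)%N)
  (fun i x => T i x)).
rewrite -[RHS]det_cumulative_cols; congr (\det _); apply/matrixP => i j.
rewrite !mxE.
have -> : (c j).+1 = b j.+1 by rewrite /b inord_val.
pose G n := \sum_(0 <= x < n) T i x.
have GE l : (l < k.+1)%N ->
    \sum_(x < b k.+1 | (b l <= x < b l.+1)%N) T i x = G (b l.+1) - G (b l).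
  move=> ltl; have lebl : (b l <= b l.+1)%N by rewrite b_mono // leqnSn.
  rewrite /G (@big_cat_nat _ _ _ (b l) 0 (b l.+1)) //= [RHS]addrC addKr.
  have leb : (b l.+1 <= b k.+1)%N by rewrite b_mono // ltl leqnn.
  rewrite (big_nat_widen _ _ (b k.+1)) // (big_nat_widenl _ 0) // big_mkord.
  by apply: eq_bigl => x; rewrite andbC.
under [RHS]eq_bigr => l _ do rewrite mxE GE //.
rewrite -(big_mkord xpredT (T i)) -/(G _).
(* As [b 0] is [0], [G (b 0)] is an empty sum; inserting it turns the entry into a full telescoping
   sum over the blocks. *)
have -> : G (b j.+1) = G (b j.+1) - G (b 0%N) by rewrite {3}/G big_geq ?subr0.
rewrite -(@telescope_sumr _ 0 j.+1 (fun l => G (b l))) //.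
rewrite (big_nat_widen _ _ k.+1) // big_mkord.
by apply: eq_bigl => l; rewrite ltnS.
Qed.

End Determinants.

(** * Minors of an array satisfying the recurrence, over an abstract cone [P] closed under sums and
    products *)

Section Minors.
Variables (R : comNzRingType) (P : R -> Prop).
Hypotheses (P0 : P 0) (P1 : P 1).
Hypotheses (PD : forall x y, P x -> P y -> P (x + y)).
Hypotheses (PM : forall x y, P x -> P y -> P (x * y)).

Lemma minor_partial_sums (k : nat) (T : 'I_k -> nat -> R) (c : 'I_k -> nat) :
  increasing c ->
  (forall d : 'I_k -> nat, increasing d -> P (\det (\matrix_(i, j) T i (d j)))) ->
  P (\det (\matrix_(i, j) \sum_(x < (c j).+1) T i x)).
Proof.
case: k T c => [|k] T c c_incr PT; first by rewrite det_mx00.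
rewrite det_partial_sums //; apply: (big_ind P) => // f /familyP fQ.
apply: PT => j j' ltjj'; have := fQ j; have := fQ j'.
(* One index per block is automatically increasing: [f j < b j.+1 <= b j' <= f j']. *)
rewrite !unfold_in => /andP[le_j' _] /andP[_ lt_j]; apply: (leq_trans lt_j).
apply: leq_trans le_j'; rewrite inord_val; case: (val j') ltjj' (ltn_ord j').
  by [].
move=> l; rewrite ltnS leq_eqVlt => /predU1P[<- _|ltjl ltl].
  by rewrite inord_val.
by rewrite ltnS ltnW // c_incr // inordK // (ltn_trans (ltnSn l)).
Qed.

Variables (m : nat) (a : nat -> R) (S : nat -> nat -> R).
Hypothesis Pa : forall i, P (a i).
Hypothesis S0 : forall j, S 0 j = 1.
Hypothesis SS : forall n j, S n.+1 j = \sum_(i < j.+1) a i * S n (i + m)%N.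

(** The factor [T]: the differences of consecutive columns of [S]. *)
Definition unsummed (n j : nat) : R :=
  if n is n'.+1 then a j * S n' (j + m)%N else (j == 0%N)%:R.

Lemma sum_unsummed (n j : nat) : S n j = \sum_(x < j.+1) unsummed n x.
Proof.
case: n => [|n]; last by rewrite SS.
by rewrite S0 big_ord_recl big1 ?addr0.
Qed.

(** Only the rows are bounded: the recurrence lowers the row index but shifts the columns up by
    [m]. *)
Definition minors_below (N : nat) : Prop :=
  forall (k : nat) (r c : 'I_k -> nat), increasing r -> increasing c ->
    (forall i, (r i < N)%N) -> P (\det (\matrix_(i, j) S (r i) (c j))).

(** Every row has a predecessor, so [a (c j)] factors out of column [j] as a diagonal matrix and a
    minor of [S] one row lower remains. *)
Lemma minor_unsummed_pos (N k : nat) (r c : 'I_k -> nat) :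
  minors_below N -> increasing r -> increasing c ->
  (forall i, (0 < r i <= N)%N) ->
  P (\det (\matrix_(i, j) unsummed (r i) (c j))).
Proof.
move=> PN r_incr c_incr r_le.
have -> : \matrix_(i, j) unsummed (r i) (c j) =
    (\matrix_(i, j) S (r i).-1 (c j + m)%N) *m diag_mx (\row_j a (c j)).
  rewrite mul_mx_diag; apply/matrixP => i j; rewrite !mxE.
  by case: (r i) (r_le i) => //= n _; rewrite mulrC.
rewrite det_mulmx det_diag; apply: PM; last first.
  by apply: (big_ind P) => // j _; rewrite mxE.
apply: (PN k (fun i => (r i).-1) (fun j => (c j + m)%N)).
- move=> i i' /r_incr ltr.
  have /andP[r_gt0 _] := r_le i; have /andP[r_gt0' _] := r_le i'.
  by rewrite /= -ltnS !prednK.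
- by move=> j j' /c_incr; rewrite ltn_add2r.
- by move=> i; have /andP[r_gt0 ler] := r_le i; rewrite /= prednK.
Qed.

(** Since [r] increases, only the first selected row can be row [0]. Its entries past the first
    vanish, because the later columns have positive index; Laplace expansion then leaves [0] or [1]
    times a minor with positive rows. *)
Lemma minor_unsummed (N k : nat) (r c : 'I_k -> nat) :
  minors_below N -> increasing r -> increasing c ->
  (forall i, (r i <= N)%N) ->
  P (\det (\matrix_(i, j) unsummed (r i) (c j))).
Proof.
case: k r c => [|k] r c PN r_incr c_incr r_le; first by rewrite det_mx00.
have r_gt0 i : (r ord0 < r (lift ord0 i))%N by apply: r_incr.
have c_gt0 j : (c ord0 < c (lift ord0 j))%N by apply: c_incr.
have [r0|r0] := posnP (r ord0); last first.
  apply: minor_unsummed_pos PN r_incr c_incr _ => i.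
  rewrite r_le andbT; case: (unliftP ord0 i) => [i'|] -> //.
  exact: ltn_trans r0 (r_gt0 i').
rewrite (expand_det_row _ ord0) big_ord_recl big1 ?addr0; last first.
  by move=> j _; rewrite mxE r0 /= gtn_eqF ?mul0r // (leq_ltn_trans _ (c_gt0 j)).
rewrite mxE r0 /=; apply: PM; first by case: eqP.
rewrite /cofactor expr0 mul1r.
have -> : row' ord0 (col' ord0 (\matrix_(i, j) unsummed (r i) (c j))) =
    \matrix_(i, j) unsummed (r (lift ord0 i)) (c (lift ord0 j)).
  by apply/matrixP => i j; rewrite !mxE.
apply: (minor_unsummed_pos (r := fun i => r (lift ord0 i))
                           (c := fun j => c (lift ord0 j)) PN).
- by move=> i i' ltii'; apply: r_incr; rewrite /= /bump !leq0n !add1n ltnS.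
- by move=> i i' ltii'; apply: c_incr; rewrite /= /bump !leq0n !add1n ltnS.
- by move=> i; rewrite r_le andbT (leq_ltn_trans _ (r_gt0 i)).
Qed.

Lemma minors_belowP (N : nat) : minors_below N.
Proof.
elim: N => [|N IHN] k r c r_incr c_incr r_lt.
  case: k r c r_incr c_incr r_lt => [|k] r c _ _ r_lt; first by rewrite det_mx00.
  by have := r_lt ord0.
have -> : \matrix_(i, j) S (r i) (c j) =
    \matrix_(i, j) \sum_(x < (c j).+1) unsummed (r i) x.
  by apply/matrixP => i j; rewrite !mxE sum_unsummed.
apply: (minor_partial_sums (T := fun i => unsummed (r i))) => // d d_incr.
exact: minor_unsummed IHN r_incr d_incr _.
Qed.

Lemma minor_recurrence (k : nat) (r c : 'I_k -> nat) :
  increasing r -> increasing c -> P (\det (\matrix_(i, j) S (r i) (c j))).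
Proof.
move=> r_incr c_incr; apply: (@minors_belowP (\max_i r i).+1) => // i.
by rewrite ltnS leq_bigmax.
Qed.

End Minors.

(** * The recurrence for path sums, by the last step *)

Section Recurrence.
Variables (R : comNzRingType) (m : nat) (alpha : nat -> R).

Lemma path_end_rcons p s b :
  path_end m p (rcons s b) = step_end m (path_end m p s) b.
Proof. by rewrite /path_end foldl_rcons. Qed.

Lemma is_partial_Dyck_rcons p s b :
  is_partial_Dyck m p (rcons s b) =
  is_partial_Dyck m p s && step_ok m (path_end m p s) b.
Proof. by elim: s p => [|b' s IHs] p /=; rewrite ?andbT // IHs andbA. Qed.

Lemma path_weight_rcons p s b :
  path_weight m alpha p (rcons s b) =
  path_weight m alpha p s * step_weight m alpha (path_end m p s) b.
Proof.
by elim: s p => [|b' s IHs] p /=; rewrite ?mul1r ?mulr1 // IHs mulrA.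
Qed.

(** Freeing the length from the form [m.+1 * n + j] lets a single step be removed without arithmetic
    on the endpoint. *)
Definition path_sum (N h : nat) : R :=
  \sum_(s : N.-tuple bool |
        is_partial_Dyck m (0%N, 0%N) s && (path_end m (0%N, 0%N) s == (N, h)))
     path_weight m alpha (0%N, 0%N) s.

Lemma big_tuple_rcons (N : nat) (Q : pred (seq bool)) (F : seq bool -> R) :
  \sum_(s : N.+1.-tuple bool | Q s) F s =
  \sum_(s : N.-tuple bool | Q (rcons s true)) F (rcons s true) +
  \sum_(s : N.-tuple bool | Q (rcons s false)) F (rcons s false).
Proof.
pose h (x : N.-tuple bool * bool) : N.+1.-tuple bool := [tuple of rcons x.1 x.2].
have h_bij : bijective h.
  apply: inj_card_bij; last by rewrite card_prod !card_tuple card_bool expnSr.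
  move=> [s b] [s' b'] /(congr1 val) /= /eqP; rewrite eqseq_rcons.
  by case/andP => /eqP/val_inj -> /eqP ->.
rewrite (reindex h) /=; last exact: onW_bij.
rewrite big_mkcond -(pair_big xpredT xpredT
  (fun (s : N.-tuple bool) b => if Q (rcons s b) then F (rcons s b) else 0)) /=.
rewrite [in RHS]big_mkcond [X in _ + X]big_mkcond -big_split /=.
by apply: eq_bigr => s _; rewrite big_bool.
Qed.

(** The last step is a rise from height [h - 1], impossible when [h] is [0], or a fall from height
    [h + m], whose weight is [alpha h] in the shifted indexing. *)
Lemma path_sumS (N h : nat) :
  path_sum N.+1 h =
  (if h is h'.+1 then path_sum N h' else 0) + alpha h * path_sum N (h + m)%N.
Proof.
rewrite /path_sum (big_tuple_rcons N
  (fun s => is_partial_Dyck m (0%N, 0%N) s &&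
            (path_end m (0%N, 0%N) s == (N.+1, h)))
  (path_weight m alpha (0%N, 0%N))).
have end1 (s : N.-tuple bool) : (path_end m (0%N, 0%N) s).1 = N.
  by rewrite path_end1 size_tuple.
congr (_ + _).
  case: h => [|h].
    rewrite big_pred0 // => s.
    by rewrite path_end_rcons /step_end xpair_eqE andbF andbF.
  apply: eq_big => s; last first.
    by rewrite path_weight_rcons /step_weight mulr1.
  rewrite path_end_rcons is_partial_Dyck_rcons /step_end /= andbT.
  by rewrite [path_end _ _ _ in RHS]surjective_pairing !xpair_eqE.
rewrite mulr_sumr; apply: eq_big => s.
  rewrite path_end_rcons is_partial_Dyck_rcons /step_end /step_ok /=.
  rewrite [path_end _ _ _ in RHS]surjective_pairing !xpair_eqE end1 !eqxx /=.
  rewrite -andbA; congr (_ && _).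
  (* Below height [m] the truncated subtraction could still give [h], but the fall is forbidden and
     the height cannot equal [h + m]. *)
  case: leqP => [lem|ltm] /=; first by rewrite -(eqn_add2r m) subnK.
  by apply/esym/eqP => e; rewrite e ltnNge leq_addl in ltm.
rewrite path_end_rcons is_partial_Dyck_rcons => /andP[/andP[_ le_m]].
rewrite /step_end xpair_eqE => /andP[_ /eqP <-].
by rewrite path_weight_rcons /step_weight mulrC.
Qed.

(** Reaching height [j] in [j] steps forces every step to be a rise; the fall term in the recurrence
    would start from a height exceeding the number of steps. *)
Lemma stieltjes_rogers0 (j : nat) : stieltjes_rogers m alpha 0 j = 1.
Proof.
have le_end s : ((path_end m (0%N, 0%N) s).2 <= size s)%N.
  elim/last_ind: s => // s b IHs; rewrite path_end_rcons size_rcons /step_end.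
  case: b => //=; apply: leq_trans (leq_subr _ _) _; exact: leqW.
have path0 h : forall N, (N < h)%N -> path_sum N h = 0.
  move=> N ltNh; rewrite /path_sum big_pred0 // => s; apply/andP => -[_ /eqP e].
  by have := le_end s; rewrite e size_tuple /= leqNgt ltNh.
rewrite /stieltjes_rogers muln0 add0n -/(path_sum j j).
elim: j => [|j IHj]; last first.
  by rewrite path_sumS IHj path0 ?mulr0 ?addr0 // leq_addr.
rewrite /path_sum (big_pred1 [tuple]) //= => s.
by rewrite tuple0 /= eqxx.
Qed.

(** Removing a final rise lowers [j] and keeps [n.+1], while removing a final fall gives the entry
    [(n, j + m)]. Iterating over the trailing rises produces the sum over the height [i] at which
    the last fall lands. *)
Lemma stieltjes_rogersS (n j : nat) :
  stieltjes_rogers m alpha n.+1 j =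
  \sum_(i < j.+1) alpha i * stieltjes_rogers m alpha n (i + m)%N.
Proof.
have step h : path_sum (m.+1 * n.+1 + h) h =
    (if h is h'.+1 then path_sum (m.+1 * n.+1 + h') h' else 0)
    + alpha h * stieltjes_rogers m alpha n (h + m)%N.
  rewrite /stieltjes_rogers -/(path_sum _ _).
  (* Length and height match again after the fall: [n] drops by one and the height grows by [m]. *)
  have -> : (m.+1 * n.+1 + h = (m.+1 * n + (h + m)).+1)%N.
    by rewrite mulnS (addnC h) -addnS -addSn addnA (addnC m.+1).
  rewrite path_sumS; case: h => // h; congr (path_sum _ _ + _).
  by rewrite addSnnS addnCA mulnS [RHS]addnC (addnC m.+1).
rewrite /stieltjes_rogers -/(path_sum _ _).
elim: j => [|j IHj]; first by rewrite step big_ord_recr big_ord0.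
by rewrite step IHj [RHS]big_ord_recr.
Qed.

End Recurrence.

Lemma coef_nonnegD (p q : Zalpha) :
  coef_nonneg p -> coef_nonneg q -> coef_nonneg (p + q).
Proof. by move=> Pp Pq u; rewrite mcoeffD addr_ge0. Qed.

Lemma coef_nonnegM (p q : Zalpha) :
  coef_nonneg p -> coef_nonneg q -> coef_nonneg (p * q).
Proof.
move=> Pp Pq u; rewrite mcoeffMl; apply: sumr_ge0 => v _; apply: sumr_ge0 => w _.
by rewrite mulrn_wge0 // mulr_ge0.
Qed.

Theorem theorem3p3 (m : nat) (hm : (0 < m)%N) :
  totally_positive (fun n j : nat => stieltjes_rogers m indet n j).
Proof.
move=> k r c r_incr c_incr.
apply: (minor_recurrence (P := coef_nonneg) (S := stieltjes_rogers m indet)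
  _ _ _ _ _ (stieltjes_rogers0 m indet) (stieltjes_rogersS m indet)) => //.
- by move=> u; rewrite mcoeff0.
- by move=> u; rewrite mcoeff1 ler0n.
- exact: coef_nonnegD.
- exact: coef_nonnegM.
- by move=> i u; rewrite mcoeffU mulrn_wge0.
Qed.
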